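(* Consider the online hiring problem with costs drawn i.i.d. from the uniform distribution $U[0,1]$ (the algorithm may know the distribution and $n$). No online algorithm has strict competitive ratio below $2.148$, i.e., for every online algorithm $\sup_{n\in\mathbb{N}}\mathbf{E}[\textsc{Alg}_n]/\mathbf{E}[\textsc{Opt}_n]\ge 2.148$.
   Context: Online hiring problem: there are $n$ time steps; in time step $i$ applicant $i$ arrives and its cost $x_i$ is revealed, where $x_1,\dots,x_n$ are drawn independently from a distribution $X$. Immediately and irrevocably at time $i$, based only on $x_1,\dots,x_i$ and earlier decisions, the algorithm chooses a nonnegative integer duration $t_i$; applicant $i$ is then under contract during time steps $i,\dots,i+t_i-1$. At every time step $s\in\{1,\dots,n\}$ at least one applicant must be under contract. The cost is $\sum_i t_ix_i$; $\textsc{Alg}_n$ denotes the cost of the online algorithm and $\textsc{Opt}_n$ the minimum cost of a feasible solution knowing all $x_1,\dots,x_n$ in advance. *)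

(* Defs.v *)
From HB Require Import structures.
From mathcomp Require Import all_boot all_order all_algebra finmap.
From mathcomp Require Import all_classical all_reals all_analysis.

Set Implicit Arguments.
Unset Strict Implicit.
Unset Printing Implicit Defensive.

Import Order.TTheory GRing.Theory Num.Theory.
Import numFieldNormedType.Exports.

Local Open Scope classical_set_scope.
Local Open Scope ring_scope.

(* Time steps and applicants are numbered from 0: applicant i : 'I_n arrives at
   step i and, when hired for t i steps, is under contract during the steps
   i, ..., i + t i - 1. Contracts may overlap and may exceed the horizon n. *)
Definition feasible (n : nat) (t : 'I_n -> nat) : Prop :=
  forall s : 'I_n, exists i : 'I_n, (i <= s < i + t i)%N.

Definition cost (R : realType) (n : nat) (x : 'I_n -> R) (t : 'I_n -> nat) : R :=
  \sum_(i < n) (t i)%:R * x i.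

(* The infimum is a minimum whenever the costs x are nonnegative. *)
Definition opt (R : realType) (n : nat) (x : 'I_n -> R) : R :=
  inf [set cost x t | t in @feasible n].

Definition revealed (R : realType) (n : nat) (x : 'I_n -> R) (i : 'I_n) :
  i.+1.-tuple R := [tuple x (widen_ord (ltn_ord i) j) | j < i.+1].

(* An online algorithm for the horizon n. The seed u : S is its internal
   randomness; a deterministic algorithm ignores it. The earlier decisions are
   themselves functions of the seed and of the earlier costs, so they need not
   be passed to the rule as a separate argument. *)
Record online_algorithm (R : realType) (dS : measure_display)
    (S : measurableType dS) (n : nat) := OnlineAlgorithm {
  duration : forall i : 'I_n, S -> i.+1.-tuple R -> nat ;
  measurable_duration : forall i : 'I_n,
    measurable_fun [set: S * i.+1.-tuple R] (fun p => duration p.1 p.2) ;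
  feasible_duration : forall (u : S) (x : 'I_n -> R),
    (forall i, 0 <= x i <= 1) ->
    feasible (fun i => duration u (revealed x i)) }.

Definition alg (R : realType) (dS : measure_display) (S : measurableType dS)
    (n : nat) (A : online_algorithm R S n) (u : S) (x : 'I_n -> R) : R :=
  cost x (fun i => duration A u (revealed x i)).

Section Randomness.
Context (R : realType) (dT : measure_display) (T : measurableType dT).
Variable P : probability T R.

Definition mutually_independent (X : nat -> {RV P >-> R}) : Prop :=
  forall (J : {fset nat}) (B : nat -> set R),
    (forall j, measurable (B j)) ->
    P (\bigcap_(j in [set` J]) (X j @^-1` B j)) =
    (\prod_(j <- J) P (X j @^-1` B j))%E.

Definition uniform01 (X : {RV P >-> R}) : Prop :=
  forall B : set R, measurable B ->
    distribution P X B = uniform_prob (@ltr01 R) B.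

Definition independent_of_costs (dS : measure_display) (S : measurableType dS)
    (U : {RV P >-> S}) (X : nat -> {RV P >-> R}) : Prop :=
  forall (C : set S) (J : {fset nat}) (B : nat -> set R),
    measurable C -> (forall j, measurable (B j)) ->
    P (U @^-1` C `&` \bigcap_(j in [set` J]) (X j @^-1` B j)) =
    (P (U @^-1` C) * P (\bigcap_(j in [set` J]) (X j @^-1` B j)))%E.

Definition expected_alg (dS : measure_display) (S : measurableType dS)
    (U : {RV P >-> S}) (X : nat -> {RV P >-> R}) (n : nat)
    (A : online_algorithm R S n) : \bar R :=
  'E_P[fun w => alg A (U w) (fun i : 'I_n => X i w)].

Definition expected_opt (X : nat -> {RV P >-> R}) (n : nat) : \bar R :=
  'E_P[fun w => opt (fun i : 'I_n => X i w)].

End Randomness.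

(* Main.v *)
Require Import Defs.
From HB Require Import structures.
From mathcomp Require Import all_boot all_order all_algebra finmap.
From mathcomp Require Import all_classical all_reals all_analysis.
From mathcomp Require Import measurable_realfun.
From mathcomp Require Import ring lra zify.

Set Implicit Arguments.
Unset Strict Implicit.
Unset Printing Implicit Defensive.

Import Order.TTheory GRing.Theory Num.Theory.
Import numFieldNormedType.Exports.

Local Open Scope classical_set_scope.
Local Open Scope ring_scope.

(* With m steps left, c of them already covered, the optimal remaining cost is
   at least max(0, kappa ln (m / c) - O(1)) for every kappa < e. Indeed, letting
   one step pass raises -kappa ln c by about kappa / c, whereas an applicant of
   price x lowers it by at most max_t (kappa ln (t / c) - t x)
   = kappa ln (kappa / (e c x)), whose mean over uniform x is kappa^2 / (e c).
   Here kappa = 2.15, ln c becomes ln (c + 6) with a small correction at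
   c = 0, 1, and the truncation at 0 makes the loss 1 / m due to the shrinking
   horizon negligible against 1 / c. Hence E[Alg_n] >= 2.15 ln n - O(1), while
   E[Opt_n] <= ln n + O(1), Opt_n being at most the sum of the prefix minima. *)

(** Averaging over prices only ever uses events [X i <= a]: the logarithmic gain is majorized by a
    finite step function of the price, so the mean of the credit is a finite combination of
    probabilities. The tight cases are the small coverages. At c = 0 a hire is forced and ln c would
    be infinite, whence the shift by 6. But a contract of length t leaves t - 1 covered steps, so
    after the shift the gain acquires a linear term 5 x, which pushes its mean above the ideal value
    when c is small. The correction [gap] spends slack available at c = 0 to repair c = 1, and a
    little of it is passed on to c = 2. The constant 2.15 only has to exceed 2.148: the difference,
    multiplied by ln n, eventually outweighs all additive constants. *)

Section Logarithm.
Context {R : realType}.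
Implicit Types x y d : R.

Lemma ln_leB1 x : 0 < x -> ln x <= x - 1.
Proof.
by move=> x0; rewrite -{1}(subrK 1 x) addrC; apply: le_ln1Dx; lra.
Qed.

Lemma ln_ge1BV x : 0 < x -> 1 - x^-1 <= ln x.
Proof.
move=> x0; have := @ln_leB1 x^-1; rewrite invr_gt0 lnV ?posrE// => /(_ x0).
lra.
Qed.

(** Certifies numerical upper bounds on logarithms by rational arithmetic alone, since
    [(1 + v / N) ^+ N] never exceeds [expR v]. *)
Lemma ln_le_expr (n : nat) (v y : R) :
  0 < y -> 0 <= v -> y <= (1 + v / n.+1%:R) ^+ n.+1 -> ln y <= v.
Proof.
move=> y0 v0 yv.
have w0 : 0 <= v / n.+1%:R by rewrite divr_ge0.
have w1 : 0 < 1 + v / n.+1%:R by rewrite ltr_pwDl.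
apply: (@le_trans _ _ (ln ((1 + v / n.+1%:R) ^+ n.+1))).
  by rewrite ler_ln ?posrE// exprn_gt0.
rewrite lnXn// -[leLHS]mulr_natr -[leRHS](@divfK _ n.+1%:R) ?pnatr_eq0//.
by rewrite ler_wpM2r// le_ln1Dx// (lt_le_trans _ w0)// ltrN10.
Qed.

(** The function [f] has derivative [(x - 1) ^+ 2 / (x * (x + 1) ^+ 2)], hence is nondecreasing, and
    [f 1 = 2]. *)
Lemma ln_ge_pade y : 1 <= y -> 2 * (y - 1) / (y + 1) <= ln y.
Proof.
move=> y1; pose f := fun x : R => ln x + 4 / (x + 1).
have fD x : 0 < x -> is_derive x 1 f (x^-1 - 4 / (x + 1) ^+ 2).
  move=> x0; have := @is_derive1_ln R x x0 => dln.
  have x1 : x + 1 != 0 by rewrite gt_eqF//; lra.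
  rewrite /f; apply: is_deriveD; rewrite /=.
  rewrite (_ : - (4 / (x + 1) ^+ 2) = 4 *: (- (x + 1) ^- 2 *: (1 + 0))); last first.
    by rewrite addr0 /GRing.scale/= mulr1 mulrN.
  by apply: is_deriveZ; apply: (@is_deriveV _ (fun z => z + 1)).
have : f 1 <= f y.
  have H : {in `[1, y]%R &, {homo f : x z / x <= z}}.
    apply: ger0_derive1_le_cc.
    - move=> x; rewrite in_itv/= => /andP[x1 _].
      have x0 : 0 < x by lra.
      exact: (@ex_derive _ _ _ _ _ _ _ (fD x x0)).
    - move=> x; rewrite in_itv/= => /andP[x1 _].
      have x0 : 0 < x by lra.
      rewrite derive1E (@derive_val _ _ _ _ _ _ _ (fD x x0)).
      rewrite (_ : _ - _ = (x - 1) ^+ 2 / (x * (x + 1) ^+ 2)).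
        by rewrite divr_ge0 ?sqr_ge0// mulr_ge0 ?sqr_ge0// ltW.
      by field; rewrite !gt_eqF//; lra.
    - apply: derivable_within_continuous => x; rewrite in_itv/= => /andP[x1 _].
      have x0 : 0 < x by lra.
      exact: (@ex_derive _ _ _ _ _ _ _ (fD x x0)).
  by apply: H => //; rewrite in_itv/= ?lexx ?y1.
rewrite /f ln1 => H; have y1' : y + 1 != 0 by rewrite gt_eqF//; lra.
have -> : 2 * (y - 1) / (y + 1) = 2 - 4 / (y + 1) by field.
by move: H; rewrite (_ : 4 / (1 + 1) = 2 :> R); [lra | field].
Qed.

(** The simpler lower bound [1 / (d + 1)] would be too weak for the constants used at d = 6, 7,
    8. *)
Lemma ln_succ_ge d : 0 < d -> 2 / (2 * d + 1) <= ln (d + 1) - ln d.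
Proof.
move=> d0; have d1 : 0 < d + 1 by lra.
rewrite -ln_div ?posrE//; apply: le_trans (ln_ge_pade _); last first.
  by rewrite ler_pdivlMr//; lra.
by rewrite le_eqVlt; apply/orP; left; apply/eqP; field; rewrite !gt_eqF//; lra.
Qed.

End Logarithm.

(** * Step-function majorant of the logarithmic gain *)

Section GeometricMajorant.
Context {R : realType}.
Variables (q lam beta u0 eta : R).
Hypotheses (q0 : 0 < q) (q1 : q < 1) (lamq : - ln q <= lam).
Hypotheses (beta0 : 0 <= beta) (beta1 : beta <= 1) (u00 : 0 < u0) (u01 : u0 <= 1).
Hypothesis crossing : - ln u0 - eta + beta * u0 * (2 - q) <= 0.

(* Majorizes the gain u |-> - ln u - eta + beta u by a step function on the grid
   u0 q^k; crossing says that u0 lies just beyond the zero of the gain. *)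
Definition step_weight (k : nat) : R := lam - beta * u0 * (1 - q) * q ^+ k.

Let bu0 : 0 <= beta * u0. Proof. exact: mulr_ge0 (ltW u00). Qed.
Let bu1 : beta * u0 <= 1. Proof. exact: mulr_ile1 (ltW u00) _ _. Qed.

Let lam_ge : 1 - q <= lam.
Proof. by have := ln_leB1 q0; move: lamq; lra. Qed.

Lemma step_weight_ge0 k : 0 <= step_weight k.
Proof.
rewrite subr_ge0; apply: le_trans lam_ge.
have Bq : 0 <= beta * u0 * (1 - q) by rewrite mulr_ge0// subr_ge0 ltW.
apply: (@le_trans _ _ (beta * u0 * (1 - q))).
  by rewrite ler_piMr// exprn_ile1// ltW.
by rewrite ler_piMl// subr_ge0 ltW.
Qed.

Lemma sum_step_weight K :
  \sum_(k < K) step_weight k = lam * K%:R - beta * u0 * (1 - q ^+ K).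
Proof.
elim: K => [|K IH]; first by rewrite big_ord0 expr0; ring.
by rewrite big_ord_recr/= IH /step_weight exprS -natr1; ring.
Qed.

(** Weight k dominates the rise of the gain from [u0 * q ^+ k] to [u0 * q ^+ k.+1]: [- ln u] grows
    by [- ln q <= lam], and [beta * u] falls by [beta * u0 * (1 - q) * q ^+ k]. Inside a cell
    [- ln u] is bounded at the left end but [beta * u] at the right end; this mismatch, at most
    [beta * u0 * (1 - q)], is why [crossing] has [2 - q] in place of 1. *)
Lemma step_majorant K u : u0 * q ^+ K < u -> u <= 1 ->
  - ln u - eta + beta * u <=
  \sum_(k < K) step_weight k * (u <= u0 * q ^+ k)%R%:R.
Proof.
move=> + u1; elim: K => [|K IH]; rewrite ?big_ord0 ?big_ord_recr/=.
  (* Beyond [u0] the gain stays nonpositive because it decreases on (0, 1]: [ln u - ln u0 >= (u -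
     u0) / u >= beta * (u - u0)]. *)
  rewrite expr0 mulr1 => u0u; have u_gt0 : 0 < u by exact: lt_trans u0u.
  have : - (ln u - ln u0) <= - (1 - (u / u0)^-1).
    by rewrite -ln_div ?posrE// lerN2 ln_ge1BV// divr_gt0.
  rewrite invf_div => H.
  have : beta * (u - u0) <= 1 - u0 / u.
    have -> : 1 - u0 / u = (u - u0) / u by field; rewrite gt_eqF.
    rewrite mulrC ler_wpM2l ?subr_ge0 ?(ltW u0u)//.
    by rewrite (le_trans beta1)// invf_ge1.
  have : 0 <= beta * u0 * (1 - q) by rewrite mulr_ge0// subr_ge0 ltW.
  by move: crossing H; rewrite /=; lra.
move=> uK; have uK0 : 0 < u0 * q ^+ K.+1 by rewrite mulr_gt0// exprn_gt0.
have [uqK|uqK] := leP u (u0 * q ^+ K); last first.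
  by rewrite mulr0 addr0; exact: IH.
rewrite (eq_bigr (fun k : 'I_K => step_weight k)); last first.
  move=> k _; rewrite (le_trans uqK) ?mulr1// ler_wpM2l ?(ltW u00)//.
  by rewrite ler_wiXn2l ?(ltW q0) ?(ltW q1)// ltnW.
rewrite mulr1 -(big_ord_recr K (fun k : 'I_K.+1 => step_weight k))/=.
rewrite sum_step_weight.
have lnu : - ln u <= - ln u0 + lam * K.+1%:R.
  have : ln (u0 * q ^+ K.+1) <= ln u.
    by rewrite ler_ln ?posrE ?ltW// (lt_trans uK0).
  rewrite lnM ?posrE ?exprn_gt0// lnXn// -mulr_natr.
  have : - ln q * K.+1%:R <= lam * K.+1%:R by rewrite ler_wpM2r.
  lra.
have bu : beta * u <= beta * u0 * q ^+ K by rewrite -mulrA ler_wpM2l.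
have qq : 0 <= beta * u0 * ((1 - q) * (1 - q ^+ K)).
  by rewrite mulr_ge0// mulr_ge0// subr_ge0 ?(ltW q1)// exprn_ile1 ?ltW.
rewrite exprS; move: qq; rewrite mulrBr mulr1 mulrBl mul1r.
move: crossing lnu bu; move: (q ^+ K) => y.
nra.
Qed.

(** The bound is the full geometric series. As q tends to 1 with [lam / (1 - q)] tending to 1 it
    becomes [u0 * (1 - beta * u0 / 2)], the exact integral of the gain over (0, u0) when [u0] is its
    zero. *)
Lemma step_weight_mean K :
  \sum_(k < K) step_weight k * (u0 * q ^+ k) <=
  u0 * (lam / (1 - q) - beta * u0 / (1 + q)).
Proof.
have q1' : 1 - q != 0 by rewrite gt_eqF// subr_gt0.
have q2' : 1 + q != 0 by rewrite gt_eqF// addr_gt0.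
have -> : \sum_(k < K) step_weight k * (u0 * q ^+ k) =
  u0 * (lam * ((1 - q ^+ K) / (1 - q)) -
        beta * u0 * ((1 - q ^+ K * q ^+ K) / (1 + q))).
  elim: K => [|K IH]; first by rewrite big_ord0 expr0 mulr1 subrr !(mul0r,mulr0) subr0 mulr0.
  by rewrite big_ord_recr/= IH /step_weight exprS; field; rewrite q1' q2'.
rewrite ler_wpM2l ?(ltW u00)//.
have y0 : 0 <= q ^+ K by rewrite exprn_ge0 ?ltW.
have y1 : q ^+ K <= 1 by rewrite exprn_ile1 ?ltW.
have L1 : 1 <= lam / (1 - q) by rewrite ler_pdivlMr ?subr_gt0// mul1r.
have B1 : beta * u0 / (1 + q) <= 1.
  by rewrite ler_pdivrMr ?addr_gt0// mul1r; move: bu1 q0; lra.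
have B0 : 0 <= beta * u0 / (1 + q) by rewrite divr_ge0// addr_ge0// ltW.
rewrite !mulrA [lam * _ / _]mulrAC [beta * u0 * _ / _]mulrAC.
move: (lam / _) (beta * u0 / _) L1 B1 B0 => a b L1 B1 B0.
move: (q ^+ K) y0 y1 => y y0 y1; nra.
Qed.

End GeometricMajorant.

(** * The potential and its one-step inequality *)

Section Potential.
Context {R : realType}.

(* With k steps covered and m left, the decision t on an applicant of price x
   costs at least the drop of Phi plus a random credit c0 - \sum p.1 [x <= p.2],
   whose mean over uniform x is nonnegative. *)
Definition one_step_bound (Phi : nat -> nat -> R) (m k : nat) : Prop :=
  exists (c0 : R) (s : seq (R * R)),
    [/\ {in s, forall p, 0 <= p.2 <= 1},
        \sum_(p <- s) p.1 * p.2 <= c0 &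
        forall (t : nat) (x : R), 0 <= x <= 1 -> (0 < maxn k t)%N ->
          Phi m k + c0 - \sum_(p <- s) p.1 * (x <= p.2)%R%:R <=
          t%:R * x + Phi m.-1 (maxn k t).-1].

Definition kappa : R := 43 / 20.

(* kappa ln (c + 6) alone violates the one-step bound at c = 1 and c = 2. *)
Definition gap (c : nat) : R :=
  if c is c'.+1 then (if c' is 0%N then 1 / 125 else 0) else 7 / 200.

(* Where level m c > 0 the factor 400 forces m >= 360 (c + 6). *)
Definition level (m c : nat) : R :=
  ln m%:R - ln (400 * (c%:R + 6)) + gap c.

Definition potential (m c : nat) : R := kappa * Num.max 0 (level m c).

Lemma gap_ge0 c : 0 <= gap c.
Proof. by rewrite /gap; case: c => [|[|c]]; lra. Qed.

Lemma gap_le c : gap c <= 7 / 200.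
Proof. by rewrite /gap; case: c => [|[|c]]; lra. Qed.

Lemma potential_ge0 m c : 0 <= potential m c.
Proof. by rewrite mulr_ge0 ?le_max ?lexx// /kappa; lra. Qed.

Lemma level_le_potential m c : kappa * level m c <= potential m c.
Proof. by rewrite ler_wpM2l ?le_max ?lexx ?orbT// /kappa; lra. Qed.

Lemma level_gt0 m c : 0 < level m c -> 360 * (c%:R + 6) < m%:R :> R.
Proof.
move=> lev; have c0 : 0 <= c%:R :> R by [].
case: m lev => [|m] lev.
  (* By convention [ln 0] is 0, so m = 0 needs its own refutation: [ln (400 * (c%:R + 6)) >= ln 2 >=
     1 / 2 > gap c]. *)
  move: lev; rewrite /level ln0// => lev.
  have : ln 1 <= ln (400 * (c%:R + 6)) :> R.
    by rewrite ler_ln ?posrE; lra.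
  have : 1 - 2^-1 <= ln (400 * (c%:R + 6)) :> R.
    apply: le_trans (ln_ge1BV _) _ => //; rewrite ler_ln ?posrE; lra.
  by move: (gap_le c) lev; lra.
have m0 : 0 < m.+1%:R :> R by [].
set M := m.+1%:R in m0 lev *; pose D : R := 400 * (c%:R + 6).
have D0 : 0 < D by rewrite /D; lra.
have : ln M - ln D <= M / D - 1 by rewrite -ln_div ?posrE// ln_leB1// divr_gt0.
move: lev (gap_le c); rewrite /level -/M -/D => lev gapc H.
have : 9 / 10 < M / D by lra.
by rewrite ltr_pdivlMr// /D; lra.
Qed.

Lemma horizon_loss m c : 0 < level m c ->
  (1 < m)%N /\ ln m%:R - ln m.-1%:R <= (300 * (c%:R + 6))^-1 :> R.
Proof.
move=> /level_gt0; have c0 : 0 <= c%:R :> R by [].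
case: m => [|[|m]]; [by lra|by lra|rewrite /= => H; split=> //].
have m1 : 0 < m.+1%:R :> R by [].
have mm : m.+2%:R = m.+1%:R + 1 :> R by rewrite -natr1.
rewrite -ln_div ?posrE//; apply: (le_trans (ln_leB1 _)); first by rewrite divr_gt0.
have -> : m.+2%:R / m.+1%:R - 1 = m.+1%:R^-1 :> R.
  by rewrite mm; field; rewrite gt_eqF.
have D0 : 0 < 300 * (c%:R + 6) :> R by lra.
rewrite lef_pV2 ?posrE; [|exact: m1|exact: D0].
rewrite -(lerD2r 1) -mm; apply: le_trans (ltW H); move: (c%:R) c0 => r r0; lra.
Qed.

Lemma level_pred m c c' : (1 < m)%N ->
  level m.-1 c' = level m c - (ln m%:R - ln m.-1%:R) +
    (ln (c%:R + 6) - ln (c'%:R + 6)) - gap c + gap c'.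
Proof.
move=> m1; have c0 : 0 <= c%:R :> R by []; have c'0 : 0 <= c'%:R :> R by [].
rewrite /level !lnM ?posrE; try lra.
Qed.

Definition grid_ratio : R := 99 / 100.
(** Equals [grid_ratio^-1 - 1], a rational upper bound of [- ln grid_ratio]. *)
Definition grid_jump : R := 1 / 99.
Local Notation q := grid_ratio.
Local Notation lam := grid_jump.

Lemma neg_ln_q : - ln q <= lam.
Proof.
have := @ln_ge1BV R q; rewrite /q /lam invf_div => H.
by have : 1 - 100 / 99 <= ln (99 / 100 : R); [apply: H|]; lra.
Qed.

(** In the variable u = d x / kappa there are three ranges: no gain from u = 1 on, [step_majorant]
    on the grid, and below the last grid point, where all K steps count and their total, at least
    [lam * K%:R - 1], exceeds the cap [V]. The cap comes from the truncation of the potential at 0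
    and makes finitely many steps enough. *)
Lemma gain_le_steps (d beta u0 eta V g x : R) (K : nat) :
  0 < d -> 0 <= beta -> beta <= 1 -> 0 < u0 -> u0 <= 1 ->
  - ln u0 - eta + beta * u0 * (2 - q) <= 0 ->
  V + 1 <= lam * K%:R -> 0 <= x -> g <= V -> (kappa / d <= x -> g <= 0) ->
  (0 < x -> g <= - ln (x / kappa * d) - eta + beta * (x / kappa * d)) ->
  g <= \sum_(k < K) step_weight q lam beta u0 k *
         (x <= kappa / d * (u0 * q ^+ k))%R%:R.
Proof.
move=> d0 b0 b1 u00 u01 cross VK x0 gV gbig gsmall.
have k0 : 0 < kappa by rewrite /kappa; lra.
have q0 : 0 < q by rewrite /q; lra.
have q1 : q < 1 by rewrite /q; lra.
have w0 k : 0 <= step_weight q lam beta u0 k.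
  by apply: step_weight_ge0 => //; exact: neg_ln_q.
have [xbig|xsmall] := leP (kappa / d) x.
  by apply: le_trans (gbig xbig) _; apply: sumr_ge0 => k _; rewrite mulr_ge0.
have eqi (z : R) : (x <= kappa / d * z) = (x / kappa * d <= z).
  by rewrite -ler_pdivrMl ?divr_gt0// invf_div mulrC mulrA mulrAC.
under eq_bigr => k _ do rewrite eqi.
set u := x / kappa * d.
have u1 : u <= 1.
  by rewrite /u -eqi mulr1 ltW.
have [uK|uK] := leP u (u0 * q ^+ K); last first.
  have u_gt0 : 0 < u by apply: le_lt_trans uK; rewrite mulr_ge0 ?exprn_ge0 ?ltW.
  have x_gt0 : 0 < x.
    rewrite lt_def x0 andbT; apply/eqP => xe; move: u_gt0.
    by rewrite /u xe !mul0r ltxx.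
  apply: le_trans (gsmall x_gt0) _.
  exact: (step_majorant q0 q1 neg_ln_q b0 b1 u00 cross uK u1).
rewrite (eq_bigr (fun k : 'I_K => step_weight q lam beta u0 k)); last first.
  move=> k _; rewrite (le_trans uK) ?mulr1// ler_wpM2l ?(ltW u00)//.
  by rewrite ler_wiXn2l ?(ltW q0) ?(ltW q1)// ltnW.
rewrite sum_step_weight; apply: le_trans gV _.
have bu0 : 0 <= beta * u0 by rewrite mulr_ge0// ltW.
have bu1 : beta * u0 <= 1 by rewrite mulr_ile1// ltW.
have y0 : 0 <= q ^+ K by rewrite exprn_ge0 ?ltW.
have : 0 <= beta * u0 * q ^+ K by rewrite mulr_ge0.
lra.
Qed.

(** Eliminates the decision: over real s the left side is maximal at s = 1 / y, by
    [ln (s * y) <= s * y - 1]. *)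
Lemma log_gain (s d y : R) : 0 < s -> 0 < d -> 0 < y ->
  ln s - ln d - s * y <= - ln (y * d) - 1.
Proof.
move=> s0 d0 y0; have := @ln_leB1 R (s * y) (mulr_gt0 s0 y0).
rewrite !lnM ?posrE//; lra.
Qed.

Lemma log_gain_lin (s d : R) : 0 < s -> 0 < d -> ln s - ln d <= (s - d) / d.
Proof.
move=> s0 d0; rewrite -ln_div ?posrE//; apply: le_trans (ln_leB1 _) _.
  by rewrite divr_gt0.
by rewrite mulrBl divff ?gt_eqF.
Qed.

Definition price_steps (d beta u0 : R) (K : nat) : seq (R * R) :=
  [seq (kappa * step_weight q lam beta u0 k, kappa / d * (u0 * q ^+ k))
     | k <- index_iota 0 K].

Lemma price_steps_itv d beta u0 K : 6 <= d -> 0 < u0 -> u0 <= 1 ->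
  {in price_steps d beta u0 K, forall p, 0 <= p.2 <= 1}.
Proof.
move=> d6 u00 u01 p /mapP[k _ ->]/=.
have k0 : 0 <= kappa / d by rewrite divr_ge0// /kappa; lra.
have k1 : kappa / d <= 1 by rewrite ler_pdivrMr /kappa; lra.
have q0 : 0 <= q ^+ k by rewrite exprn_ge0// /q; lra.
have q1 : q ^+ k <= 1 by rewrite exprn_ile1// /q; lra.
have uq0 : 0 <= u0 * q ^+ k by exact: mulr_ge0 (ltW u00) q0.
have uq1 : u0 * q ^+ k <= 1 by exact: mulr_ile1 (ltW u00) q0 u01 q1.
by apply/andP; split; [exact: mulr_ge0|exact: mulr_ile1].
Qed.

Lemma price_steps_mean d beta u0 K : 0 < d ->
  0 <= beta -> beta <= 1 -> 0 < u0 -> u0 <= 1 ->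
  \sum_(p <- price_steps d beta u0 K) p.1 * p.2 <=
  kappa * (kappa / d * (u0 * (100 / 99 - beta * u0 * (100 / 199)))).
Proof.
move=> d0 b0 b1 u00 u01; rewrite big_map big_mkord/=.
under eq_bigr => k _ do rewrite -mulrA (mulrCA _ (kappa / d)).
have kd : 0 <= kappa / d by rewrite divr_ge0 ?ltW// /kappa; lra.
rewrite -!mulr_sumr ler_wpM2l ?ler_wpM2l//; first by rewrite /kappa; lra.
have := @step_weight_mean R q lam beta u0.
rewrite (_ : lam / (1 - q) = 100 / 99); last by rewrite /lam /q; field.
rewrite (_ : (1 + q)^-1 = 100 / 199); last by rewrite /q; field.
by apply => //; rewrite /q; [lra|lra|exact: neg_ln_q].
Qed.

Lemma price_steps_sum d beta u0 K x :
  \sum_(p <- price_steps d beta u0 K) p.1 * (x <= p.2)%R%:R =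
  kappa * \sum_(k < K) step_weight q lam beta u0 k *
            (x <= kappa / d * (u0 * q ^+ k))%R%:R.
Proof.
by rewrite big_map big_mkord mulr_sumr; apply: eq_bigr => k _; exact: esym (mulrA _ _ _).
Qed.

Lemma exists_steps (V : R) : exists K : nat, V + 1 <= lam * K%:R.
Proof.
exists (Num.bound (99 * `|V + 1|)).
have := @archi_boundP R (99 * `|V + 1|); rewrite mulr_ge0//= => /(_ isT).
by have := ler_norm (V + 1); rewrite /lam; lra.
Qed.

(** The gain of a hire is measured against an idle step, which leaves shifted coverage d = k + 6.
    With s = t + 5 it is at most ln (s / d) + [gap k] - s x / kappa + 5 x / kappa. The last term is
    (5 / d) u for u = d x / kappa, hence the condition on [beta]; the forfeited [gap k] gives eta =
    1 - [gap k]. *)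
Lemma one_step_covered (m k : nat) (beta u0 : R) :
  0 < level m k.+1 -> 5 / (k%:R + 6) <= beta -> beta <= 1 ->
  0 < u0 -> u0 <= 1 ->
  - ln u0 - (1 - gap k) + beta * u0 * (2 - q) <= 0 ->
  (k%:R + 6)^-1 * (kappa * (u0 * (100 / 99 - beta * u0 * (100 / 199)))) <=
    2 / (2 * (k%:R + 6) + 1) - gap k.+1 + gap k - (300 * (k%:R + 6))^-1 ->
  one_step_bound potential m k.+1.
Proof.
move=> lev betad b1 u00 u01 cross mean.
have [m1 hor] := horizon_loss lev.
have kn : 0 <= k%:R :> R by [].
have k0 : 0 < kappa by rewrite /kappa; lra.
set d : R := k%:R + 6; have d6 : 6 <= d by rewrite /d; lra.
have d0 : 0 < d by lra.
have b0 : 0 <= beta by apply: le_trans betad; rewrite divr_ge0 ?ltW.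
have kS : k.+1%:R = k%:R + 1 :> R by rewrite -natr1.
set h := ln m%:R - ln m.-1%:R in hor.
have h0 : 0 <= h.
  have m0 : (0 < m.-1)%N by rewrite -ltnS (ltn_predK m1).
  by rewrite /h subr_ge0 ler_ln ?posrE ?ltr0n ?ler_nat ?leq_pred// ltnW.
pose Delta : R := ln (d + 1) - ln d - gap k.+1 + gap k.
have [K VK] := exists_steps (level m k.+1 + Delta).
(* [Delta - h] is the change of level in an idle step: [Delta] from the lost coverage, [h] from the
   shorter horizon. *)
exists (kappa * (Delta - h)), (price_steps d beta u0 K); split.
- exact: price_steps_itv.
- apply: (le_trans (price_steps_mean K d0 b0 b1 u00 u01)).
  rewrite ler_wpM2l ?(ltW k0)// -mulrA mulrCA.
  apply: le_trans mean _.
  have := ln_succ_ge d0; rewrite /Delta.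
  have : h <= (300 * d)^-1.
    apply: le_trans hor _; rewrite kS.
    have D0 : 0 < 300 * d by lra.
    have D1 : 0 < 300 * (k%:R + 1 + 6) :> R by lra.
    by rewrite lef_pV2 ?posrE; [rewrite /d; lra|exact: D1|exact: D0].
  by rewrite -/d; lra.
move=> t x /andP[x0 x1] kt.
rewrite price_steps_sum {1}/potential max_r ?(ltW lev)//.
pose pot' := potential m.-1 (maxn k.+1 t).-1.
rewrite -/pot'.
have pot'0 : 0 <= pot' by exact: potential_ge0.
have tx0 : 0 <= t%:R * x by rewrite mulr_ge0.
suff S : level m k.+1 + (Delta - h) - (t%:R * x + pot') / kappa <=
  \sum_(k0 < K) step_weight q lam beta u0 k0 *
         (x <= kappa / d * (u0 * q ^+ k0))%R%:R.
  have := ler_wpM2l (ltW k0) S; rewrite mulrBr mulrDr.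
  by rewrite [kappa * (_ / kappa)]mulrC divfK ?gt_eqF//; lra.
have txp := divr_ge0 (addr_ge0 tx0 pot'0) (ltW k0).
have w0 j : 0 <= step_weight q lam beta u0 j.
  by apply: step_weight_ge0 => //; rewrite /q; [lra|lra|exact: neg_ln_q].
have kk : (k.+1%:R + 6 : R) = d + 1 by rewrite kS /d; ring.
(* Such a contract ends no later than the existing cover: the coverage evolves as in an idle step,
   and the price paid only helps. *)
have [tk|tk] := leqP t k.+1.
  apply: (@le_trans _ _ 0); last by apply: sumr_ge0 => j _; rewrite mulr_ge0.
  have := level_le_potential m.-1 (maxn k.+1 t).-1; rewrite -/pot'.
  rewrite (maxn_idPl tk)/= (level_pred k.+1 k m1) -/h kk -/d => lv.
  have : level m k.+1 + (Delta - h) <= pot' / kappa.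
    by rewrite ler_pdivlMr// mulrC; apply: le_trans lv; rewrite /Delta; lra.
  have := divr_ge0 tx0 (ltW k0).
  rewrite mulrDl; lra.
have tE : (maxn k.+1 t).-1 = t.-1 by rewrite (maxn_idPr (ltnW tk)).
have t0 : (0 < t)%N by apply: leq_ltn_trans tk.
have tR : t.-1%:R + 6 = t%:R + 5 :> R by rewrite -[in RHS](prednK t0) -natr1; ring.
have tk' : d + 1 <= t%:R + 5.
  by have : (k.+2%:R <= t%:R :> R); [rewrite ler_nat|rewrite -!natr1 /d; lra].
have potg : level m k.+1 + (Delta - h) - (t%:R * x + pot') / kappa <=
    ln (t%:R + 5) - ln d + gap k - t%:R * (x / kappa).
  have := level_le_potential m.-1 (maxn k.+1 t).-1; rewrite -/pot'.
  rewrite tE (level_pred k.+1 t.-1 m1) -/h kk tR => lv.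
  have := gap_ge0 t.-1 => g0.
  have : level m k.+1 - h + (ln (d + 1) - ln (t%:R + 5)) - gap k.+1 + gap t.-1
     <= pot' / kappa by rewrite ler_pdivlMr// mulrC.
  rewrite mulrDl mulrA /Delta; lra.
apply: (@gain_le_steps d beta u0 (1 - gap k) (level m k.+1 + Delta)) => //.
- lra.
(* At such prices the linear bound on the logarithm already shows no gain: [t / d] cancels, and
   [(d - 5) / d >= 1 / 6] exceeds [gap k]. *)
- move=> xk; apply: le_trans potg _.
  have : ln (t%:R + 5) - ln d <= (t%:R + 5 - d) / d by apply: log_gain_lin => //; lra.
  have : t%:R * d^-1 <= t%:R * (x / kappa).
    by rewrite ler_wpM2l// ler_pdivlMr// mulrC.
  have -> : (t%:R + 5 - d) / d = t%:R / d - (d - 5) / d by field; rewrite gt_eqF.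
  have : 1 / 6 <= (d - 5) / d by rewrite ler_pdivlMr//; lra.
  have := gap_le k; lra.
- move=> xp; apply: le_trans potg _.
  have y0 : 0 < x / kappa by rewrite divr_gt0.
  have s0 : 0 < t%:R + 5 :> R by lra.
  have := log_gain s0 d0 y0.
  have : 5 * (x / kappa) <= beta * (x / kappa * d).
    by rewrite [leRHS]mulrCA mulrC ler_wpM2l ?(ltW y0)// -ler_pdivrMr.
  lra.
Qed.

Lemma sum_grid_lt (N : nat) (x : R) : 0 <= x ->
  \sum_(j < N) (j.+1%:R < x)%R%:R <= x.
Proof.
move=> x0; elim: N => [|N IH]; first by rewrite big_ord0.
rewrite big_ord_recr/=; have [Nx|Nx] := ltP; last by rewrite addr0.
apply: le_trans (ltW Nx); rewrite -[leRHS]natr1 lerD2r.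
rewrite -[X in _ <= X%:R]card_ord -sum1_card natr_sum; apply: ler_sum => j _.
by case: ltP.
Qed.

Lemma le_sum_grid (N : nat) (x : R) : x <= N%:R ->
  x <= \sum_(j < N) (j%:R < x)%R%:R.
Proof.
elim: N => [|N IH] xN; first by rewrite big_ord0.
rewrite big_ord_recr/=; have [Nx|Nx] := ltP; last by rewrite addr0 IH.
apply: le_trans xN _; rewrite -natr1 lerD2r.
rewrite -[X in X%:R <= _]card_ord -sum1_card natr_sum; apply: ler_sum => j _.
by rewrite (lt_trans _ Nx)// ltr_nat.
Qed.

(** One unit of the forced contract costs x, rounded down to the grid of mesh 1/100. The other t - 1
    units are a gain with s = (t - 1) + 6 and d = 6, so the linear term is 6 x / kappa, that is
    [beta = 1]. Then - ln u - 1 + u vanishes only at u = 1, which forces [u0 = 1]. *)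
Lemma one_step_uncovered (m : nat) :
  0 < level m 0 :> R -> one_step_bound potential m 0.
Proof.
move=> lev; have [m1 hor] := horizon_loss lev.
have k0 : 0 < kappa by rewrite /kappa; lra.
pose h : R := ln m%:R - ln m.-1%:R.
have hor' : h <= 1 / 1800 by move: hor; rewrite add0r -/h; lra.
have h0 : 0 <= h.
  have m0 : (0 < m.-1)%N by rewrite -ltnS (ltn_predK m1).
  by rewrite /h subr_ge0 ler_ln ?posrE ?ltr0n ?ler_nat ?leq_pred// ltnW.
have [K VK] := exists_steps (level m 0 : R).
pose grid : seq (R * R) := [seq (1 / 100, j.+1%:R / 100) | j <- index_iota 0 100].
(* The summand 1/100 raises eta to 101/100, exactly [2 - q], as [crossing] demands at
   [u0 = beta = 1]. *)
exists (1 - kappa * (gap 0 + 1 / 100 + h)), (grid ++ price_steps 6 1 1 K); split.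
- move=> p; rewrite mem_cat => /orP[|]; last by apply: price_steps_itv; lra.
  case/mapP => j; rewrite mem_index_iota => /andP[_ j100] ->/=.
  by rewrite divr_ge0//= ler_pdivrMr// mul1r ler_nat.
- rewrite big_cat/=.
  have -> : \sum_(p <- grid) p.1 * p.2 = 101 / 200.
    rewrite big_map big_mkord/= -mulr_sumr -mulr_suml.
    have -> : \sum_(i < 100) i.+1%:R = 5050 :> R.
      rewrite -natr_sum; congr (_%:R).
      by rewrite -(big_mkord xpredT (fun i => i.+1)) unlock.
    lra.
  have H : \sum_(p <- price_steps 6 1 1 K) p.1 * p.2 <=
    kappa * (kappa / 6 * (1 * (100 / 99 - 1 * 1 * (100 / 199)))).
    by apply: price_steps_mean; lra.
  apply: le_trans (lerD (lexx _) H) _; rewrite /gap /kappa; lra.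
move=> t x /andP[x0 x1] t0; rewrite max0n in t0 *.
rewrite big_cat/= price_steps_sum {1}/potential max_r ?(ltW lev)//.
set S := \sum_(k < K) _.
have Hx : 1 - \sum_(p <- grid) p.1 * (x <= p.2)%R%:R <= x.
  rewrite big_map big_mkord/= -mulr_sumr.
  have H100 : 0 <= 100 * x by lra.
  have := sum_grid_lt 100 H100.
  rewrite (eq_bigr (fun j : 'I_100 => 1 - (x <= j.+1%:R / 100)%R%:R)).
    rewrite sumrB sumr_const card_ord; lra.
  move=> j _; rewrite ler_pdivlMr// mulrC.
  by case: leP => _; rewrite ?subrr ?subr0.
pose pot' : R := potential m.-1 t.-1.
have pot'0 : 0 <= pot' by exact: potential_ge0.
rewrite -/pot'.
have tE : t%:R = t.-1%:R + 1 :> R by rewrite natr1 prednK.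
have r0 : 0 <= t.-1%:R :> R by [].
have rx0 : 0 <= t.-1%:R * x by rewrite mulr_ge0.
suff HS : level m 0 - h - gap 0 - 1 / 100 - (t.-1%:R * x + pot') / kappa <= S.
  have := ler_wpM2l (ltW k0) HS; rewrite mulrBr [kappa * (_ / kappa)]mulrC divfK ?gt_eqF//.
  by rewrite tE /gap; lra.
have txp := divr_ge0 (addr_ge0 rx0 pot'0) (ltW k0).
have potg : level m 0 - h - gap 0 - 1 / 100 - (t.-1%:R * x + pot') / kappa <=
    ln (t.-1%:R + 6) - ln 6 - 1 / 100 - t.-1%:R * (x / kappa).
  have := level_le_potential m.-1 t.-1 : _ <= _ :> R; rewrite -/pot'.
  rewrite (level_pred 0 t.-1 m1) -/h add0r => lv.
  have := gap_ge0 t.-1 : _ <= _ :> R => g0.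
  have : level m 0 - h + (ln 6 - ln (t.-1%:R + 6)) - gap 0 + gap t.-1
     <= pot' / kappa by rewrite ler_pdivlMr// mulrC.
  rewrite mulrDl mulrA; lra.
have gap00 : 0 <= gap 0 :> R by exact: gap_ge0.
rewrite /S; apply: (@gain_le_steps 6 1 1 (101 / 100) (level m 0)) => //.
- by rewrite ln1 /grid_ratio; lra.
- lra.
- move=> xk; apply: le_trans potg _.
  have : ln (t.-1%:R + 6) - ln 6 <= (t.-1%:R + 6 - 6) / 6 :> R by apply: log_gain_lin => //; lra.
  have : t.-1%:R * 6^-1 <= t.-1%:R * (x / kappa).
    by rewrite ler_wpM2l// ler_pdivlMr// mulrC.
  lra.
- move=> xp; apply: le_trans potg _.
  have y0 : 0 < x / kappa by rewrite divr_gt0.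
  have s0 : 0 < t.-1%:R + 6 :> R by lra.
  have d0 : 0 < 6 :> R by lra.
  have := log_gain s0 d0 y0.
  lra.
Qed.

Lemma one_step_potential (m k : nat) : one_step_bound potential m k.
Proof.
have [lev|lev] := leP (level m k : R) 0.
  exists 0, [::]; split; rewrite ?big_nil// => t x /andP[x0 x1] _.
  rewrite big_nil {1}/potential max_l// mulr0 !subr0 addr0.
  exact: addr_ge0 (mulr_ge0 (ler0n _ _) x0) (potential_ge0 _ _).
case: k lev => [|[|[|k]]] lev.
- exact: one_step_uncovered.
- apply: (@one_step_covered _ _ (5 / 6) (68 / 100)) => //; rewrite ?add0r/gap/kappa/grid_ratio; try lra.
  rewrite -lnV ?posrE; last lra.
  have : ln (68 / 100 : R)^-1 <= 39 / 100.
    by apply: (@ln_le_expr _ 31); lra.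
  lra.
  have -> : 2 / (2 * 6 + 1) = 2 / 13 :> R by congr (_ / _); ring.
  have -> : (300 * 6)^-1 = 1 / 1800 :> R by field.
  lra.
- apply: (@one_step_covered _ _ (5 / 7) (56 / 100)) => //; rewrite ?add0r/gap/kappa/grid_ratio; try lra.
  rewrite -lnV ?posrE; last lra.
  have : ln (56 / 100 : R)^-1 <= 73 / 125.
    by apply: (@ln_le_expr _ 63); lra.
  lra.
  have -> : 1 + 6 = 7 :> R by ring.
  have -> : 2 / (2 * 7 + 1) = 2 / 15 :> R by congr (_ / _); ring.
  have -> : (300 * 7)^-1 = 1 / 2100 :> R by field.
  lra.
have kn : 0 <= k%:R :> R by [].
have kS : k.+2%:R = k%:R + 2 :> R by rewrite -addn2 natrD.
apply: (@one_step_covered _ _ (5 / 8) (64 / 125)); rewrite ?kS /gap/kappa/grid_ratio; [exact: lev| |lra|lra|lra| |].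
- by rewrite ler_pdivrMr//; lra.
- rewrite -lnV ?posrE; last lra.
  have : ln (64 / 125 : R)^-1 <= 27 / 40.
    by apply: (@ln_le_expr _ 63); lra.
  lra.
- set d : R := k%:R + 2 + 6; have d8 : 8 <= d by rewrite /d; lra.
  have d0 : 0 < d by lra.
  (* For d >= 8 this makes every term a multiple of [d^-1], leaving one numerical inequality. *)
  have : 16 / 17 * d^-1 <= 2 / (2 * d + 1).
    rewrite ler_pdivlMr; last lra.
    rewrite mulrAC ler_pdivrMr//; lra.
  rewrite invfM.
  have : 0 <= d^-1 by rewrite invr_ge0 ltW.
  move: (d^-1) (2 / (2 * d + 1)) => a b; lra.
Qed.

End Potential.

(** * Coverage, telescoping and measurability *)

Section Coverage.
Context {R : realType}.

(* The number of steps from i on that contracts made before i already cover. *)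
Fixpoint coverage (t : nat -> nat) (i : nat) : nat :=
  if i is j.+1 then (maxn (coverage t j) (t j)).-1 else 0.

Lemma coverage_ge t i j : (j < i)%N -> (j + t j - i <= coverage t i)%N.
Proof.
elim: i => [//|i IH]; rewrite ltnS leq_eqVlt => /predU1P[->|ji] /=.
  lia.
by have := IH ji; lia.
Qed.

Lemma feasible_coverage n (t : nat -> nat) :
  feasible (fun i : 'I_n => t i) ->
  forall i, (i < n)%N -> (0 < maxn (coverage t i) (t i))%N.
Proof.
move=> ft i ilt; have [j /andP[ji ijt]] := ft (Ordinal ilt).
move: ji ijt; rewrite /= leq_eqVlt => /predU1P[<-|ji] ijt; first by lia.
by have := coverage_ge t ji; lia.
Qed.

Definition online_duration (dS : measure_display) (S : measurableType dS)
    (n : nat) (A : online_algorithm R S n) (u : S) (x : nat -> R) (i : nat) : nat :=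
  if insub i is Some o then duration A u (revealed (fun j : 'I_n => x j) o)
  else 0.

Lemma online_durationE (dS : measure_display) (S : measurableType dS) (n : nat)
    (A : online_algorithm R S n) u x (o : 'I_n) :
  online_duration A u x o = duration A u (revealed (fun j : 'I_n => x j) o).
Proof. by rewrite /online_duration valK. Qed.

Section Telescoping.
Variables (Phi : nat -> nat -> R) (c0 : nat -> nat -> R).
Variable (s : nat -> nat -> seq (R * R)).
Hypothesis step : forall m k (t : nat) (x : R), 0 <= x <= 1 ->
  (0 < maxn k t)%N ->
  Phi m k + c0 m k - \sum_(p <- s m k) p.1 * (x <= p.2)%R%:R <=
  t%:R * x + Phi m.-1 (maxn k t).-1.

Lemma telescoping n (t : nat -> nat) (x : nat -> R) :
  (forall i, (i < n)%N -> 0 <= x i <= 1) ->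
  (forall i, (i < n)%N -> (0 < maxn (coverage t i) (t i))%N) ->
  Phi n 0 + \sum_(i < n) (c0 (n - i) (coverage t i) -
     \sum_(p <- s (n - i) (coverage t i)) p.1 * (x i <= p.2)%R%:R) <=
  \sum_(i < n) (t i)%:R * x i + Phi 0%N (coverage t n).
Proof.
move=> x01 cov.
suff H j : (j <= n)%N ->
  Phi n 0 + \sum_(i < j) (c0 (n - i) (coverage t i) -
     \sum_(p <- s (n - i) (coverage t i)) p.1 * (x i <= p.2)%R%:R) <=
  \sum_(i < j) (t i)%:R * x i + Phi (n - j)%N (coverage t j).
  by have := H n (leqnn n); rewrite subnn.
elim: j => [|j IH] jn; first by rewrite !big_ord0 subn0 addr0 add0r.
rewrite !big_ord_recr/= subnS.
have := IH (ltnW jn).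
have := step (n - j) (x01 j jn) (cov j jn).
set a := Phi _ _; set b := Phi _ _; set c := \sum_(p <- _) _; set d := c0 _ _.
set e := \sum_(i < j) _; set f := \sum_(i < j) _; lra.
Qed.

End Telescoping.

Section Measurability.
Context (dS : measure_display) (S : measurableType dS).
Context (dT : measure_display) (T : measurableType dT).
Variables (n : nat) (A : online_algorithm R S n).
Variables (U : T -> S) (X : nat -> T -> R).
Hypothesis mU : measurable_fun setT U.

(** The sigma-algebra on [T] is left open: the ambient one and the one generated by the past are
    both used later. *)
Lemma measurable_online_duration i :
  (forall j, (j <= i)%N -> measurable_fun setT (X j)) ->
  measurable_fun setT (fun w => online_duration A (U w) (X^~ w) i).
Proof.
move=> mX; rewrite /online_duration; case: insubP => [k _ oi | _]; last first.
  exact: measurable_cst.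
have mR : measurable_fun setT (fun w => revealed (fun j : 'I_n => X j w) k).
  apply/measurable_fun_tnthP => j.
  rewrite (_ : _ \o _ = X j); first by apply: mX; rewrite -oi -ltnS.
  by apply/funext => w /=; rewrite tnth_mktuple.
exact: (measurableT_comp (@measurable_duration _ _ _ _ A k) (measurable_fun_pair mU mR)).
Qed.

Lemma measurable_coverage i :
  (forall j, (j < i)%N -> measurable_fun setT (X j)) ->
  measurable_fun setT
    (fun w => coverage (online_duration A (U w) (X^~ w)) i).
Proof.
elim: i => [|i IH] mX /=; first exact: measurable_cst.
apply: (@measurableT_comp _ _ _ _ _ _ predn) => //.
apply: measurable_fun_maxn.
  by apply: IH => j ji; apply: mX; exact: ltnW.
exact: measurable_online_duration.
Qed.

End Measurability.

End Coverage.

(** * Independence of the current cost from the past *)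

Section Independence.
Context (R : realType) (dT : measure_display) (T : measurableType dT).
Variable P : probability T R.

Lemma independent_lambda_system (B : set T) : measurable B ->
  lambda_system setT [set E | measurable E /\ P (E `&` B) = (P E * P B)%E].
Proof.
move=> mB; split => //.
- by split=> //=; rewrite setTI probability_setT mul1e.
- move=> E F FE [mE PE] [mF PF]; split; first exact: measurableD.
  have mEB := measurableI _ _ mE mB; have mFB := measurableI _ _ mF mB.
  have -> : (E `\` F) `&` B = (E `&` B) `\` (F `&` B).
    by apply/seteqP; split=> w /=; tauto.
  rewrite !measureD//; try by rewrite ltey_eq fin_num_measure.
  rewrite (setIidr FE) (setIidr (setSI (C := B) FE)).
  rewrite /= PE PF muleBl ?fin_num_measure//.
  by apply: fin_num_adde_defl; rewrite ?fin_numN fin_num_measure.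
- move=> F ndF HF; have mF i : measurable (F i) by case: (HF i).
  have mbF : measurable (\bigcup_i F i) by exact: bigcup_measurable.
  split => //.
  have c1 : P \o F @ \oo --> P (\bigcup_i F i) by exact: nondecreasing_cvg_mu.
  have c2 : P \o (fun i => F i `&` B) @ \oo --> P (\bigcup_i (F i `&` B)).
    apply: nondecreasing_cvg_mu => //.
    - by move=> i; exact: measurableI.
    - by apply: bigcup_measurable => i _; exact: measurableI.
    - by move=> i j ij; apply/subsetPset; apply: setSI; apply/subsetPset/ndF.
  rewrite setI_bigcupl -(cvg_lim _ c2)//; apply: cvg_lim => //.
  rewrite (_ : _ \o _ = (fun i => P (F i) * P B)%E); last first.
    by apply/funext => i /=; case: (HF i).
  by apply: cvgeZr => //; rewrite fin_num_measure.
Qed.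

Section Past.
Context (dS : measure_display) (S : measurableType dS).
Variables (U : {RV P >-> S}) (X : nat -> {RV P >-> R}).
Hypotheses (hXind : mutually_independent X) (hU : independent_of_costs U X).

(* A pi-system generating the sigma-algebra of U, X_0, ..., X_(i-1). *)
Definition past_system (i : nat) : set (set T) :=
  [set E | exists (C : set S) (B : nat -> set R),
    [/\ measurable C, forall j, measurable (B j) &
     E = U @^-1` C `&` \bigcap_(j in [set` [fset k in iota 0 i]%fset]) (X j @^-1` B j)]].

Lemma past_index i j : [set` [fset k in iota 0 i]%fset] j = (j < i)%N.
Proof. by rewrite /= !inE mem_iota add0n. Qed.

Lemma past_system_setI i : setI_closed (past_system i).
Proof.
move=> _ _ [C [B [mC mB ->]]] [C' [B' [mC' mB' ->]]].
exists (C `&` C'), (fun j => B j `&` B' j); split.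
- exact: measurableI.
- by move=> j; exact: measurableI.
rewrite setIACA -bigcapI preimage_setI; congr (_ `&` _).
Qed.

Lemma past_system_measurable i : past_system i `<=` measurable.
Proof.
move=> _ [C [B [mC mB ->]]]; apply: measurableI.
  by rewrite -[X in measurable X]setTI; exact: measurable_funPT.
apply: fin_bigcap_measurable => // j _.
by rewrite -[X in measurable X]setTI; exact: measurable_funPT.
Qed.

(** For an event of [past_system], adding index i with the set [B0] gives again a product event, and
    the hypotheses factor it. The pi-lambda theorem extends this to the generated sigma-algebra. *)
Lemma independent_past i (E : set T) (B0 : set R) :
  measurable B0 -> <<s past_system i >> E ->
  P (E `&` (X i @^-1` B0)) = (P E * P (X i @^-1` B0))%E.
Proof.
move=> mB0; have mXB : measurable (X i @^-1` B0).
  by rewrite -[X in measurable X]setTI; exact: measurable_funPT.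
move=> sE; suff: [set E | measurable E /\
    P (E `&` (X i @^-1` B0)) = (P E * P (X i @^-1` B0))%E] E by case.
move: E sE; apply: lambda_system_subset => //.
- exact: past_system_setI.
- exact: independent_lambda_system.
move=> E sE; split; first exact: (@past_system_measurable i).
case: sE => C [D [mC mD ->]].
pose D' j := if j == i then B0 else D j.
have mD' j : measurable (D' j) by rewrite /D'; case: ifP.
set J := [fset k in iota 0 i]%fset.
have iJ : i \notin J by rewrite !inE mem_iota add0n ltnn andbF.
have DD' : \bigcap_(j in [set` J]) (X j @^-1` D j) =
    \bigcap_(j in [set` J]) (X j @^-1` D' j).
  apply: eq_bigcapr => j; rewrite past_index => ji.
  by rewrite /D' ltn_eqF.
have DiJ : \bigcap_(j in [set` (i |` J)%fset]) (X j @^-1` D' j) =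
    (\bigcap_(j in [set` J]) (X j @^-1` D j)) `&` (X i @^-1` B0).
  by rewrite set_fsetU1 bigcap_setU1 setIC DD' {2}/D' eqxx.
rewrite -setIA -DiJ (hU _ mC mD') (hXind _ mD') big_fsetU1//= {1}/D' eqxx.
by rewrite DD' (hU J mC mD') (hXind J mD') [in LHS]muleCA [RHS]muleC.
Qed.

Lemma measurable_past i j : (j < i)%N ->
  measurable_fun setT (X j : g_sigma_algebraType (past_system i) -> R).
Proof.
move=> ji _ B mB; rewrite setTI; apply: sub_sigma_algebra.
exists setT, (fun k => if k == j then B else setT); split=> //.
  by move=> k; case: ifP.
rewrite preimage_setT setTI; apply/seteqP; split=> [w Bw k _|w].
  by rewrite /preimage/=; case: eqP => [->|].
by move/(_ j); rewrite past_index eqxx; apply.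
Qed.

Lemma measurable_seed_past i :
  measurable_fun setT (U : g_sigma_algebraType (past_system i) -> S).
Proof.
move=> _ C mC; rewrite setTI; apply: sub_sigma_algebra.
exists C, (fun=> setT); split=> //; rewrite [X in _ `&` X](_ : _ = setT) ?setIT//.
by apply/seteqP; split.
Qed.

Hypothesis hXunif : forall i, uniform01 (X i).

Lemma uniform_le i (a : R) : 0 <= a <= 1 ->
  P (X i @^-1` [set x | x <= a]) = a%:E.
Proof.
move=> /andP[a0 a1].
have mB : measurable [set x : R | x <= a] by rewrite -set_itvNyc; exact: measurable_itv.
rewrite -[LHS]/(distribution P (X i) _) hXunif// /uniform_prob.
rewrite integral_uniform_pdf (_ : _ `&` _ = `[0, a]%classic); last first.
  apply/seteqP; split=> x /=; rewrite !in_itv/=; first by move=> [-> /andP[-> _]].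
  by move=> /andP[x0 xa]; split=> //; rewrite x0 (le_trans xa).
rewrite (eq_integral (fun=> 1%E)); last first.
  move=> x; rewrite inE/= in_itv/= => /andP[x0 xa].
  by rewrite /uniform_pdf x0 (le_trans xa)//= subr0 invr1.
rewrite integral_cst//= mul1e lebesgue_measure_itv/= lte_fin.
by case: ltP => [_|]; rewrite ?sube0// => ?; congr EFin; apply/le_anti/andP.
Qed.

Lemma costs_in_itv : {ae P, forall w, forall i, 0 <= X i w <= 1}.
Proof.
apply/ae_foralln => i.
have mB : measurable (~` `[0, 1]%classic : set R) by exact: measurableC.
exists (X i @^-1` (~` `[0, 1]%classic)); split.
- by rewrite -[X in measurable X]setTI; exact: measurable_funPT.
- rewrite -[LHS]/(distribution P (X i) _) hXunif// /uniform_prob.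
  by rewrite integral_uniform_pdf setICl integral_set0.
- by move=> w; apply: contra_not => /=; rewrite /= in_itv/=.
Qed.

Variables (n : nat) (A : online_algorithm R S n).

Definition coverage_at (i : nat) (w : T) : nat :=
  coverage (online_duration A (U w) (fun j => X j w)) i.

Lemma measurable_coverage_at i : measurable_fun setT (coverage_at i).
Proof.
exact: (@measurable_coverage R dS S dT T n A U (fun j => X j)).
Qed.

(** Here the online condition enters: the coverage before step i depends only on the seed and on the
    costs before i. *)
Lemma coverage_independent i k (a : R) : 0 <= a <= 1 ->
  P ((coverage_at i @^-1` [set k]) `&` (X i @^-1` [set x | x <= a])) =
  (P (coverage_at i @^-1` [set k]) * a%:E)%E.
Proof.
move=> a01; rewrite independent_past ?uniform_le//.
  by rewrite -set_itvNyc; exact: measurable_itv.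
rewrite -[X in <<s _ >> X]setTI.
apply: (@measurable_coverage R dS S _ (g_sigma_algebraType (past_system i)) n A U (fun j => X j)) => //.
- exact: measurable_seed_past.
- by move=> j; exact: measurable_past.
Qed.

End Past.

End Independence.

(** * Linear calculus of means *)

Section Mean.
Context (R : realType) (dT : measure_display) (T : measurableType dT).
Variable P : probability T R.

Definition has_mean (f : T -> R) (r : R) : Prop :=
  P.-integrable setT (EFin \o f) /\ (\int[P]_w (f w)%:E = r%:E)%E.

Lemma has_mean_indic (E : set T) : measurable E -> has_mean \1_E (fine (P E)).
Proof.
move=> mE; split; first exact: integrable_indic.
by rewrite integral_indic// setIT fineK// fin_num_measure.
Qed.

Lemma has_mean_cst (c : R) : has_mean (fun=> c) c.
Proof.
split; first exact: finite_measure_integrable_cst.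
by rewrite integral_cst//= probability_setT mule1.
Qed.

Lemma has_meanZ (c : R) f r : has_mean f r -> has_mean (fun w => c * f w) (c * r).
Proof.
move=> [intf fr]; split.
  rewrite (_ : _ \o _ = (fun w => c%:E * (EFin \o f) w)%E); first exact: integrableZl.
  by apply/funext => w /=; rewrite EFinM.
by under eq_integral do rewrite EFinM; rewrite integralZl// fr.
Qed.

Lemma has_meanD f g r s :
  has_mean f r -> has_mean g s -> has_mean (fun w => f w + g w) (r + s).
Proof.
move=> [intf fr] [intg gs]; split.
  rewrite (_ : _ \o _ = (EFin \o f) \+ (EFin \o g))%E; first exact: integrableD.
  by apply/funext => w /=; rewrite EFinD.
by under eq_integral do rewrite EFinD; rewrite integralD_EFin//= fr gs.
Qed.

Lemma has_meanB f g r s :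
  has_mean f r -> has_mean g s -> has_mean (fun w => f w - g w) (r - s).
Proof.
move=> mf /(has_meanZ (-1)) mg; have := has_meanD mf mg.
by rewrite mulN1r (_ : (fun w => f w + -1 * g w) = (fun w => f w - g w))//;
  apply/funext => w; rewrite mulN1r.
Qed.

Lemma has_mean_sum (I : Type) (s : seq I) (f : I -> T -> R) (r : I -> R) :
  (forall i, has_mean (f i) (r i)) ->
  has_mean (fun w => \sum_(i <- s) f i w) (\sum_(i <- s) r i).
Proof.
move=> fr; elim: s => [|i s IH].
  rewrite big_nil (_ : (fun w => _) = (fun=> 0)); first exact: has_mean_cst.
  by apply/funext => w; rewrite big_nil.
rewrite big_cons (_ : (fun w => _) = (fun w => f i w + \sum_(j <- s) f j w)).
  exact: has_meanD.
by apply/funext => w; rewrite big_cons.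
Qed.

End Mean.

(** * Lower bound on the expected cost of the algorithm *)

Section ExpectedAlg.
Context (R : realType) (dT : measure_display) (T : measurableType dT).
Variable P : probability T R.
Variables (X : nat -> {RV P >-> R}).
Hypotheses (hXind : mutually_independent X) (hXunif : forall i, uniform01 (X i)).
Context (dS : measure_display) (S : measurableType dS).
Variable U : {RV P >-> S}.
Hypothesis hU : independent_of_costs U X.
Variables (n : nat) (A : online_algorithm R S n).

Lemma algE w : alg A (U w) (fun i : 'I_n => X i w) =
  \sum_(i < n) (online_duration A (U w) (fun j => X j w) i)%:R * X i w.
Proof. by apply: eq_bigr => i _; rewrite online_durationE. Qed.

Lemma measurable_alg :
  measurable_fun setT (fun w => alg A (U w) (fun i : 'I_n => X i w)).
Proof.
under eq_fun do rewrite algE.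
apply: measurable_sum => i; apply: measurable_funM => //.
apply: (@measurableT_comp _ _ _ _ _ _ (fun k : nat => k%:R : R)) => //.
exact: (@measurable_online_duration R dS S dT T n A U (fun j => X j)).
Qed.

Variable Phi : nat -> nat -> R.
Hypotheses (Phi_ge0 : forall m k, 0 <= Phi m k).
Hypothesis Phi_eq0 : forall m k, (m <= k)%N -> Phi m k = 0.
Hypothesis Phi_step : forall m k, one_step_bound Phi m k.

Lemma expected_alg_ge : ((Phi n 0)%:E <= expected_alg U X A)%E.
Proof.
(* Contracts may outlast the horizon, so the coverage is unbounded; a null credit for m <= k lets
   [g] sum over k < n only. *)
have /choice[cs Hcs] : forall mk : nat * nat, exists cs : R * seq (R * R),
    [/\ (mk.1 <= mk.2)%N -> cs = (0, [::]),
        {in cs.2, forall p, 0 <= p.2 <= 1},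
        \sum_(p <- cs.2) p.1 * p.2 <= cs.1 &
        forall (t : nat) (x : R), 0 <= x <= 1 -> (0 < maxn mk.2 t)%N ->
          Phi mk.1 mk.2 + cs.1 - \sum_(p <- cs.2) p.1 * (x <= p.2)%R%:R <=
          t%:R * x + Phi mk.1.-1 (maxn mk.2 t).-1].
  move=> [m k]/=; have [mk|mk] := leqP m k.
    exists (0, [::]); split=> //=; first by rewrite big_nil.
    move=> t x /andP[x0 _] _; rewrite big_nil Phi_eq0// subr0 addr0.
    by rewrite addr_ge0// mulr_ge0.
  have [c0 [s [H1 H2 H3]]] := Phi_step m k.
  by exists (c0, s); split=> //; rewrite leqNgt mk.
pose c0 m k := (cs (m, k)).1; pose s m k := (cs (m, k)).2.
pose E i k := coverage_at U X A i @^-1` [set k].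
have mE i k : measurable (E i k).
  by rewrite -[X in measurable X]setTI; exact: measurable_coverage_at.
pose g w := \sum_(i < n) \sum_(k < n) (c0 (n - i)%N k * \1_(E i k) w -
  \sum_(p <- s (n - i)%N k) p.1 * \1_(E i k `&` (X i @^-1` [set x | x <= p.2])) w).
pose r := \sum_(i < n) \sum_(k < n) (c0 (n - i)%N k * fine (P (E i k)) -
  \sum_(p <- s (n - i)%N k)
    p.1 * fine (P (E i k `&` (X i @^-1` [set x | x <= p.2])))).
have mXle i (a : R) : measurable (X i @^-1` [set x | x <= a]).
  rewrite -[X in measurable X]setTI; apply: measurable_funPT => //.
  by rewrite -set_itvNyc; exact: measurable_itv.
have gr : has_mean P g r.
  apply: has_mean_sum => i; apply: has_mean_sum => k; apply: has_meanB.
    exact/has_meanZ/has_mean_indic.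
  apply: has_mean_sum => p; apply: has_meanZ; apply: has_mean_indic.
  exact: measurableI.
have r0 : 0 <= r.
  apply: sumr_ge0 => i _; apply: sumr_ge0 => k _.
  have [_ s01 sc _] := Hcs ((n - i)%N, k : nat).
  rewrite (@eq_big_seq _ _ _ _ _ _ (fun p => p.1 * p.2 * fine (P (E i k)))).
    rewrite -mulr_suml -mulrBl mulr_ge0 ?subr_ge0// fine_ge0//.
  move=> p /s01 p01; rewrite -mulrA; congr (_ * _).
  rewrite (coverage_independent hXind hU hXunif A i k p01) fineM ?fin_num_measure//; last exact: mE.
  by rewrite mulrC.
have gE w : g w = \sum_(i < n) (c0 (n - i)%N (coverage_at U X A i w) -
  \sum_(p <- s (n - i)%N (coverage_at U X A i w)) p.1 * (X i w <= p.2)%R%:R).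
  apply: eq_bigr => i _; set k := coverage_at _ _ _ _ _.
  have ind (k' : nat) : \1_(E i k') w = (k == k')%:R :> R.
    rewrite indicE; congr ((nat_of_bool _)%:R); apply/idP/eqP => [|e]; last by rewrite inE /E/= -e.
    by rewrite inE /E.
  have ind2 (k' : nat) a : \1_(E i k' `&` (X i @^-1` [set x | x <= a])) w =
      (k == k')%:R * (X i w <= a)%R%:R :> R.
    rewrite indicI/= ind; congr (_ * _); rewrite indicE; congr ((nat_of_bool _)%:R).
    by apply/idP/idP; rewrite ?inE.
  under eq_bigr => k' _.
    rewrite ind; under eq_bigr => p _ do rewrite ind2 mulrCA.
    rewrite -mulr_sumr [c0 _ _ * _]mulrC -mulrBr; over.
  have [kn|nk] := ltnP k n.
    rewrite (bigD1 (Ordinal kn))//= eqxx mul1r [X in _ + X]big1 ?addr0// => k' kk'.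
    by rewrite (_ : (k == k') = false) ?mul0r//; apply/eqP => e; move: kk'; rewrite -val_eqE/= -e eqxx.
  rewrite big1.
    have [H _ _ _] := Hcs ((n - i)%N, k).
    by rewrite /c0 /s H/= ?big_nil ?subr0// (leq_trans (leq_subr _ _)).
  by move=> k' _; rewrite gtn_eqF ?mul0r// (leq_trans (ltn_ord k')).
have Lr := has_meanD (has_mean_cst P (Phi n 0)) gr.
have [intL meanL] := Lr.
have ae_le : {ae P, forall w, 0 <= alg A (U w) (fun i : 'I_n => X i w) /\
    Phi n 0 + g w <= alg A (U w) (fun i : 'I_n => X i w)}.
  apply: filterS (costs_in_itv hXunif) => w x01; split.
    by rewrite algE; apply: sumr_ge0 => i _; rewrite mulr_ge0//; have /andP[] := x01 i.
  have := @telescoping R Phi c0 s _ n (online_duration A (U w) (fun j => X j w))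
    (fun j => X j w).
  rewrite (Phi_eq0 (leq0n _)) addr0 gE algE; apply.
  - by move=> m k t x x1 kt; have [_ _ _] := Hcs (m, k); apply.
  - by move=> i _; exact: x01.
  - apply: feasible_coverage.
    have := @feasible_duration _ _ _ _ A (U w) (fun i : 'I_n => X i w).
    rewrite (_ : (fun i : 'I_n => online_duration _ _ _ i) =
      (fun i => duration A (U w) (revealed (fun i0 : 'I_n => X i0 w) i))).
      by apply => i; exact: x01.
    by apply/funext => i; rewrite online_durationE.
rewrite /expected_alg unlock.
have malg : measurable_fun setT (fun w => (alg A (U w) (fun i : 'I_n => X i w))%:E).
  exact/measurable_EFinP/measurable_alg.
have mabs : measurable_fun setT (fun w => `|(alg A (U w) (fun i : 'I_n => X i w))%:E|%E).
  exact: measurableT_comp.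
(* The cost is nonnegative only almost surely, hence the absolute value. It may have infinite mean
   and [L] may be negative, so the comparison passes through the positive part of [L]. *)
rewrite (@ae_eq_integral _ _ _ P setT
  (fun w => `|(alg A (U w) (fun i : 'I_n => X i w))%:E|%E))//; last first.
  by apply: filterS ae_le => w [a0 _] _; rewrite gee0_abs ?lee_fin.
pose L := EFin \o (fun w => Phi n 0 + g w).
have le1 : ((Phi n 0)%:E <= \int[P]_w L w)%E by rewrite meanL lee_fin lerDl.
have le2 : (\int[P]_w L w <= \int[P]_w L^\+ w)%E.
  apply: le_integral => //; first exact: integrable_funepos.
  by move=> w _; rewrite funeposE le_max lexx.
apply: (le_trans le1); apply: (le_trans le2).
apply: ae_ge0_le_integral => //.
- by apply: measurable_funepos; case/integrableP : intL.
- by apply: filterS ae_le => w [a0 La] _; rewrite gee0_abs ?lee_fin// funeposE ge_max !lee_fin La.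
Qed.

End ExpectedAlg.

(** * The optimum is at most the sum of the prefix minima *)

Section PrefixMinimum.
Context {R : realType}.
Variable x : nat -> R.

Fixpoint prefix_argmin (s : nat) : nat :=
  if s is r.+1 then (if x s < x (prefix_argmin r) then s else prefix_argmin r)
  else 0.

Lemma prefix_argmin_le s : (prefix_argmin s <= s)%N.
Proof. by elim: s => [//|s IH] /=; case: ifP => // _; exact: leqW. Qed.

Lemma prefix_argmin_min s i : (i <= s)%N -> x (prefix_argmin s) <= x i.
Proof.
elim: s => [|s IH]; first by rewrite leqn0 => /eqP->.
rewrite leq_eqVlt => /predU1P[->|].
  by rewrite [prefix_argmin _]/=; case: ltP.
rewrite ltnS => /IH le; rewrite [prefix_argmin _]/=; case: ltP => // lt.
exact: le_trans (ltW lt) le.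
Qed.

(** Ties keep the earlier index, so the argmin only ever changes to the current step. *)
Lemma prefix_argmin_const s r :
  (prefix_argmin s <= r <= s)%N -> prefix_argmin r = prefix_argmin s.
Proof.
elim: s => [|s IH]; first by rewrite /= leqn0 => /eqP->.
have [->//|rs] := eqVneq r s.+1.
rewrite [prefix_argmin s.+1]/=; case: ifP => [_|_] H; first by lia.
by apply: IH; lia.
Qed.

(** Each step is charged to the cheapest applicant so far, who is hired for as many steps as are
    charged. By [prefix_argmin_const] the steps from [prefix_argmin s] to s all have the same payer,
    so this contract reaches s. *)
Lemma opt_le_prefix_min n : (forall i, (i < n)%N -> 0 <= x i) ->
  opt (fun i : 'I_n => x i) <= \sum_(s < n) x (prefix_argmin s).
Proof.
move=> x0; apply: ge_inf.
  by exists 0 => _ [t _ <-]; apply: sumr_ge0 => i _; rewrite mulr_ge0// x0.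
have am (s : 'I_n) : (prefix_argmin s < n)%N.
  exact: leq_ltn_trans (prefix_argmin_le s) (ltn_ord s).
pose a (s : 'I_n) : 'I_n := Ordinal (am s).
pose t (i : 'I_n) := (\sum_(s < n) (prefix_argmin s == i))%N.
exists t; last first.
  rewrite /cost /t; under eq_bigr => i _ do rewrite natr_sum mulr_suml.
  rewrite exchange_big; apply: eq_bigr => s _.
  rewrite (bigD1 (a s))//= eqxx mul1r big1 ?addr0// => i /negPf.
  by rewrite -val_eqE/= eq_sym => ->; rewrite mul0r.
move=> s; exists (a s); rewrite /= prefix_argmin_le/=.
have ge : (s.+1 - prefix_argmin s <= t (a s))%N.
  rewrite /t -(big_mkord xpredT (fun r => (prefix_argmin r == prefix_argmin s) : nat)).
  rewrite (@big_cat_nat _ _ _ (prefix_argmin s))//=; last exact: ltnW.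
  rewrite (@big_cat_nat _ _ _ s.+1 (prefix_argmin s))//=; last first.
    exact: leqW (prefix_argmin_le s).
  rewrite [X in (_ <= _ + (X + _))%N](eq_big_nat _ _ (F2 := fun=> 1%N)) => [|r /andP[ar rs]]; last first.
    by rewrite (@prefix_argmin_const s r) ?eqxx// ar -ltnS.
  rewrite sum_nat_const_nat muln1; lia.
by have := prefix_argmin_le s; lia.
Qed.

End PrefixMinimum.

(** * Upper bound on the expected optimum *)

Import HBNNSimple.

(** The integral of [f] is the supremum over simple functions below [f], and each of these is almost
    surely below [g]. This avoids proving [opt], an infimum over infinitely many decisions,
    measurable. *)
Lemma ge0_le_integral_nonmeasurable (R : realType) (dT : measure_display)
    (T : measurableType dT) (P : {measure set T -> \bar R}) (f g : T -> \bar R) :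
  (forall w, 0 <= f w)%E -> (forall w, 0 <= g w)%E -> measurable_fun setT g ->
  {ae P, forall w, f w <= g w}%E -> (\int[P]_w f w <= \int[P]_w g w)%E.
Proof.
move=> f0 g0 mg fg; rewrite ge0_integralE//; apply: ge_ereal_sup => _ [h hf <-].
rewrite -integralT_nnsfun; apply: ae_ge0_le_integral => //.
- by move=> w _; rewrite lee_fin fun_ge0.
- exact/measurable_EFinP.
apply: filterS fg => w fgw _; apply: le_trans fgw.
by have := hf w; rewrite patch_setT.
Qed.

(** A left Riemann sum of the decreasing function (1 - a)^m on [0, 1]: all terms but the first lie
    below the integral 1 / (m + 1). *)
Lemma sum_pow_grid_le (R : realFieldType) (N m : nat) : (0 < N)%N ->
  \sum_(j < N) N%:R^-1 * (1 - j%:R / N%:R) ^+ m <= N%:R^-1 + m.+1%:R^-1 :> R.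
Proof.
move=> N0; have N0' : 0 < N%:R :> R by rewrite ltr0n.
pose a j : R := 1 - j%:R / N%:R.
have key (p r : R) : 0 <= r -> r <= p ->
    (p - r) * r ^+ m <= m.+1%:R^-1 * (p ^+ m.+1 - r ^+ m.+1).
  move=> r0 rp; rewrite subrXX mulrCA ler_wpM2l ?subr_ge0//.
  rewrite ler_pdivlMl ?ltr0n// mulr_natl -[in leLHS](card_ord m.+1) -sumr_const.
  apply: ler_sum => i _; rewrite /= -[in leLHS](subnK (ltnSE (ltn_ord i))) exprD.
  by rewrite ler_wpM2r ?exprn_ge0// lerXn2r// nnegrE (le_trans r0).
suff H M : (M < N)%N -> \sum_(j < M.+1) N%:R^-1 * a j ^+ m <=
    N%:R^-1 + m.+1%:R^-1 * (1 - a M ^+ m.+1).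
  case: N N0 N0' @a key H => // N _ N0' a key H.
  apply: le_trans (H N (ltnSn N)) _; rewrite lerD2l ler_piMr ?invr_ge0//.
  rewrite lerBlDr lerDl exprn_ge0// /a subr_ge0 ler_pdivrMr// mul1r ler_nat.
  exact: leqnSn.
elim: M => [|M IH] MN.
  by rewrite big_ord_recl big_ord0 addr0 /a mul0r subr0 !expr1n mulr1 subrr mulr0 addr0.
rewrite big_ord_recr/=; apply: le_trans (lerD (IH (ltnW MN)) (lexx _)) _.
have aS : a M - a M.+1 = N%:R^-1 by rewrite /a -natr1; field; rewrite gt_eqF.
have a0 : 0 <= a M.+1.
  by rewrite /a subr_ge0 ler_pdivrMr// mul1r ler_nat ltnW.
have aM : a M.+1 <= a M by rewrite -subr_ge0 aS invr_ge0 ltW.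
have := key (a M) (a M.+1) a0 aM; rewrite aS !mulrBr.
move: (_ * a M ^+ m.+1) (_ * a M.+1 ^+ m.+1) (_ * a M.+1 ^+ m) => u v z zuv.
by rewrite -addrA lerD2l -addrA lerD2l addrC -lerBrDr opprK addrC.
Qed.

Lemma sum_harmonic_le (R : realType) (n : nat) :
  \sum_(s < n) s.+2%:R^-1 <= ln n.+1%:R :> R.
Proof.
elim: n => [|n IH]; first by rewrite big_ord0 ln1.
rewrite big_ord_recr/=; apply: le_trans (lerD IH (lexx _)) _.
have n0 : 0 < n.+1%:R :> R by rewrite ltr0n.
have n1 : 0 < n.+2%:R :> R by rewrite ltr0n.
have := @ln_ge1BV R (n.+2%:R / n.+1%:R) (divr_gt0 n1 n0).
rewrite ln_div ?posrE// invf_div.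
have -> : 1 - n.+1%:R / n.+2%:R = n.+2%:R^-1 :> R.
  by rewrite -[X in X - _](@divff _ n.+2%:R) ?gt_eqF// -mulrBl -natr1 addrAC subrr add0r mul1r.
by rewrite lerBrDl.
Qed.

Section ExpectedOpt.
Context (R : realType) (dT : measure_display) (T : measurableType dT).
Variable P : probability T R.
Variables (X : nat -> {RV P >-> R}).
Hypotheses (hXind : mutually_independent X) (hXunif : forall i, uniform01 (X i)).

Definition all_above (s : nat) (a : R) : set T :=
  \bigcap_(j in [set` [fset k in iota 0 s.+1]%fset]) (X j @^-1` [set x | a < x]).

Let mgt (a : R) : measurable [set x | a < x].
Proof. by rewrite -set_itvoy; exact: measurable_itv. Qed.

Lemma measurable_all_above s a : measurable (all_above s a).
Proof.
apply: fin_bigcap_measurable => // j _.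
by rewrite -[X in measurable X]setTI; exact: measurable_funPT.
Qed.

Lemma all_aboveE s a w : all_above s a w <-> forall j, (j <= s)%N -> a < X j w.
Proof.
split=> [H j js|H j]; first by apply: (H j); rewrite past_index ltnS.
by rewrite past_index ltnS => /H.
Qed.

Lemma prob_all_above s a : 0 <= a <= 1 ->
  P (all_above s a) = ((1 - a) ^+ s.+1)%:E.
Proof.
move=> a01; rewrite /all_above hXind//.
have Pgt j : P (X j @^-1` [set x | a < x]) = (1 - a)%:E.
  have -> : X j @^-1` [set x | a < x] = ~` (X j @^-1` [set x | x <= a]).
    by apply/seteqP; split=> w /=; rewrite ltNge => /negP.
  rewrite probability_setC ?uniform_le//.
  rewrite -[X in measurable X]setTI; apply: measurable_funPT => //.
  by rewrite -set_itvNyc; exact: measurable_itv.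
under eq_bigr => j _ do rewrite Pgt.
rewrite big_const_seq count_predT (_ : size _ = s.+1); last first.
  by rewrite card_fseq undup_id ?iota_uniq// size_iota.
by elim: s.+1 => [|k IH]; rewrite ?expr0//= IH exprS EFinM.
Qed.

Variable n : nat.
Hypothesis n0 : (0 < n)%N.

(** Rounds each prefix minimum up to the grid of mesh 1 / n; the n rounding errors add up to at most
    1 in the mean. *)
Let step_opt (w : T) : R :=
  \sum_(s < n) \sum_(j < n) n%:R^-1 * \1_(all_above s (j%:R / n%:R)) w.

Let step_opt_ge0 w : 0 <= step_opt w.
Proof.
by apply: sumr_ge0 => s _; apply: sumr_ge0 => j _; rewrite mulr_ge0 ?invr_ge0.
Qed.

Let opt_le_step : {ae P, forall w, 0 <= opt (fun i : 'I_n => X i w) <= step_opt w}.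
Proof.
apply: filterS (costs_in_itv hXunif) => w x01.
have x0 i : 0 <= X i w by have /andP[] := x01 i.
have n0' : 0 < n%:R :> R by rewrite ltr0n.
apply/andP; split.
  apply: lb_le_inf => [|_ [t _ <-]]; last first.
    by apply: sumr_ge0 => i _; rewrite mulr_ge0.
  exists (cost (fun i : 'I_n => X i w) (fun=> 1%N)); exists (fun=> 1%N) => // i.
  by exists i; rewrite addn1 leqnn ltnSn.
apply: le_trans (@opt_le_prefix_min R (fun i => X i w) n _) _ => //.
apply: ler_sum => s _; set a := prefix_argmin _ _.
rewrite -mulr_sumr ler_pdivlMl//.
have xn : n%:R * X a w <= n%:R.
  by rewrite ler_piMr//; have /andP[] := x01 a.
apply: le_trans (le_sum_grid xn) _; apply: ler_sum => j _.
case: ltP => // ja; rewrite indicE mem_set//; apply/all_aboveE => i si.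
rewrite ltr_pdivrMr// mulrC; apply: lt_le_trans ja _; rewrite ler_wpM2l//.
exact: (@prefix_argmin_min R (fun i => X i w)).
Qed.

Lemma expected_opt_itv :
  (0 <= expected_opt X n <= (ln n.+1%:R + 1)%:E)%E.
Proof.
rewrite /expected_opt unlock integralE.
set f := fun w => (opt (fun i : 'I_n => X i w))%:E.
have neg0 : (\int[P]_w f^\- w = 0)%E.
  apply/le_anti/andP; split; last by apply: integral_ge0.
  apply: (@le_trans _ _ (\int[P]_w 0)%E); last by rewrite integral0.
  apply: ge0_le_integral_nonmeasurable => //.
  apply: filterS opt_le_step => w /andP[a0 _].
  by rewrite funenegE ge_max lexx andbT leeNl oppe0 lee_fin.
rewrite neg0 sube0 integral_ge0//=.
have [intS meanS] : has_mean P step_opt (\sum_(s < n) \sum_(j < n)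
    n%:R^-1 * fine (P (all_above s (j%:R / n%:R)))).
  apply: has_mean_sum => s; apply: has_mean_sum => j.
  exact/has_meanZ/has_mean_indic/measurable_all_above.
apply: (@le_trans _ _ (\int[P]_w (step_opt w)%:E)%E).
  apply: ge0_le_integral_nonmeasurable => //.
  - by case/integrableP : intS.
  apply: filterS opt_le_step => w /andP[a0 os].
  by rewrite funeposE ge_max !lee_fin os step_opt_ge0.
rewrite meanS lee_fin.
have n0' : 0 < n%:R :> R by rewrite ltr0n.
apply: (@le_trans _ _ (\sum_(s < n) (n%:R^-1 + s.+2%:R^-1))).
  apply: ler_sum => s _; apply: le_trans (sum_pow_grid_le R s.+1 n0).
  apply: ler_sum => j _; rewrite prob_all_above//.
  by rewrite divr_ge0//= ler_pdivrMr// mul1r ler_nat ltnW.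
rewrite big_split/= sumr_const card_ord -[X in X + _]mulr_natr mulVf ?gt_eqF//.
by rewrite addrC lerD2r sum_harmonic_le.
Qed.

End ExpectedOpt.

(** * Comparison at a large horizon *)

Lemma potential_eq0 (R : realType) m k : (m <= k)%N -> potential m k = 0 :> R.
Proof.
move=> mk; rewrite /potential max_l ?mulr0// leNgt; apply/negP => /level_gt0.
have : m%:R <= k%:R :> R by rewrite ler_nat.
have : 0 <= k%:R :> R by [].
lra.
Qed.

Lemma exists_large_horizon (R : realType) : exists2 n : nat, (0 < n)%N &
  2148%:R / 1000%:R * (ln n.+1%:R + 1) <= potential n 0 :> R.
Proof.
have -> : 2148%:R / 1000%:R = 537 / 250 :> R by field.
pose l : R := ln (400 * (0%:R + 6)).
(* 500 is 1 / (2.15 - 2.148), and 8 + 3 |l| generously covers the additive terms 2 * 2.148 and 2.15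
   l. *)
have [n nC] : exists n : nat, expR (500 * (8 + 3 * `|l|)) < n%:R.
  by exists (Num.bound (expR (500 * (8 + 3 * `|l|)))); apply: archi_boundP; exact: expR_ge0.
have n0' : 0 < n%:R :> R by exact: le_lt_trans (expR_ge0 _) nC.
have n0 : (0 < n)%N by rewrite -(ltr0n R).
exists n => //.
have lnn : 500 * (8 + 3 * `|l|) <= ln n%:R.
  by rewrite -[leLHS]expRK ler_ln ?posrE ?expR_gt0// ltW.
have lnS : ln n.+1%:R <= ln n%:R + 1 :> R.
  rewrite -lerBlDl -ln_div ?posrE//; apply: le_trans (ln_leB1 _) _.
    by rewrite divr_gt0.
  have n1 : 1 <= n%:R :> R by rewrite ler1n.
  by rewrite lerBlDr ler_pdivrMr// -natr1; lra.
apply: le_trans (level_le_potential n 0); rewrite /level -/l /gap /kappa.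
have ll := ler_norm l; have l0 := normr_ge0 l.
move: lnn lnS ll l0; move: (ln n%:R) (ln n.+1%:R) `|l| (l) => a b c d; lra.
Qed.

Theorem theorem4p9 (R : realType)
    (dT : measure_display) (T : measurableType dT) (P : probability T R)
    (X : nat -> {RV P >-> R})
    (hXind : mutually_independent X) (hXunif : forall i, uniform01 (X i))
    (dS : measure_display) (S : measurableType dS) (U : {RV P >-> S})
    (hU : independent_of_costs U X)
    (A : forall n : nat, online_algorithm R S n) :
  ((2148%:R / 1000%:R : R)%:E <=
   ereal_sup [set expected_alg U X (A n) / expected_opt X n
             | n in [set n : nat | (0 < n)%N]])%E.
Proof.
have [n n0 large] := exists_large_horizon R.
apply: (@le_trans _ _ (expected_alg U X (A n) / expected_opt X n)%E); last first.
  by apply: ereal_sup_ubound; exists n.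
have algn := expected_alg_ge hXind hXunif hU (A n) potential_ge0 (@potential_eq0 R)
  one_step_potential.
have /andP[] := expected_opt_itv hXind hXunif n0.
have c0 : 0 < 2148%:R / 1000%:R :> R by rewrite divr_gt0 ?ltr0n.
move: (2148%:R / 1000%:R) c0 large => c c0 large.
have ln0 : 0 <= ln n.+1%:R :> R by rewrite ln_ge0// ler1n.
have alg0 : (0 < expected_alg U X (A n))%E.
  by apply: lt_le_trans algn; rewrite lte_fin (lt_le_trans _ large)// mulr_gt0//; lra.
case: (expected_opt X n) => [r| |]//; rewrite !lee_fin => r0 rQ.
(* A vanishing expected optimum would make the ratio infinite, since the inverse of 0 is +oo
   here. *)
have [->|r_neq0] := eqVneq r 0; first by rewrite inve0 gt0_muley// leey.
have r_gt0 : 0 < r by rewrite lt_def r_neq0.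
rewrite inver (negPf r_neq0) lee_pdivlMr//; apply: le_trans algn.
by rewrite -EFinM lee_fin (le_trans _ large)// ler_wpM2l// ltW.
Qed.
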